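(* Let $K:\mathcal X\to\mathcal Y$ be a compact linear operator with infinite dimensional range and let $R_{\alpha,\gamma}$ be the corresponding family of fractional Tikhonov regularization operators, with fixed $\gamma\ge1/2$. Let $y$ be attainable, $x^\dagger=K^\dagger y$, and let $\alpha=\alpha(\delta,y^\delta)>0$ be any parameter choice rule; write $x_{\alpha,\gamma}^\delta=R_{\alpha(\delta,y^\delta),\gamma}\,y^\delta$. If $$\sup\big\{\|x_{\alpha,\gamma}^\delta-x^\dagger\|:\ \|Q(y-y^\delta)\|\le\delta\big\}=o\big(\delta^{\frac23}\big)\qquad(\delta\to0),$$ where $Q$ is the orthogonal projector onto $\overline{R(K)}$, then $x^\dagger=0$.
   Context: $\mathcal X,\mathcal Y$ are Hilbert spaces; $R(K)$ is the range of $K$; $y$ attainable means $y\in R(K)$. $(\sigma_m;v_m,u_m)$ is the singular value expansion of $K$: $\sigma_1\ge\sigma_2\ge\dots>0$, $\{v_m\}$, $\{u_m\}$ orthonormal and complete in $(\ker K)^\perp$ and $\overline{R(K)}$, $Kv_m=\sigma_mu_m$, $K^*u_m=\sigma_mv_m$. $K^\dagger$ is the Moore-Penrose generalized inverse, $K^\dagger y=\sum_m\sigma_m^{-1}\langle y,u_m\rangle v_m$. Fractional Tikhonov method: $R_{\alpha,\gamma}y=\sum_mF_{\alpha,\gamma}(\sigma_m)\sigma_m^{-1}\langle y,u_m\rangle v_m$ with $F_{\alpha,\gamma}(\sigma)=\frac{\sigma^{2\gamma}}{(\sigma^2+\alpha)^\gamma}$, $\alpha>0$, $\gamma\ge1/2$.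 A parameter choice rule is a map $(\delta,y^\delta)\mapsto\alpha(\delta,y^\delta)\in(0,\infty)$; the supremum is over all $y^\delta\in\mathcal Y$ with the stated property. *)

(* Defs.v *)
From mathcomp Require Import all_boot all_order all_algebra.
From mathcomp Require Import complex.
From mathcomp Require Import all_classical all_reals all_analysis.

Set Implicit Arguments.
Unset Strict Implicit.
Unset Printing Implicit Defensive.

Import Order.TTheory GRing.Theory Num.Theory numFieldNormedType.Exports.

Local Open Scope classical_set_scope.
Local Open Scope ring_scope.

(* Hilbert spaces are taken over either the real or the complex numbers. *)
Variant scalar_kind := RealScalars | ComplexScalars.

Definition scalars (R : realType) (k : scalar_kind) : numFieldType :=
  match k with
  | RealScalars => R
  | ComplexScalars => R[i]
  end.

Definition sconj (R : realType) (k : scalar_kind) :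
    scalars R k -> scalars R k :=
  match k with
  | RealScalars => idfun
  | ComplexScalars => fun z : R[i] => z^*
  end.

Definition of_real (R : realType) (k : scalar_kind) : R -> scalars R k :=
  match k with
  | RealScalars => idfun
  | ComplexScalars => fun r => r%:C%C
  end.

Definition re_part (R : realType) (k : scalar_kind) : scalars R k -> R :=
  match k with
  | RealScalars => idfun
  | ComplexScalars => fun z : R[i] => complex.Re z
  end.

Record hilbert (R : realType) (k : scalar_kind) := Hilbert {
  hilbert_sort :> completeNormedModType (scalars R k);
  inner : {dot hilbert_sort for @sconj R k};
  hilbert_normE : forall x : hilbert_sort, `|x| ^+ 2 = inner x x
}.

(* Linear in the first argument, conjugate-linear in the second. *)
Notation "⟨ x , y ⟩" := (inner _ x y) (format "⟨ x ,  y ⟩") : ring_scope.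

Section Hilbert.
Variables (R : realType) (k : scalar_kind).
Implicit Types H X Y : hilbert R k.

(* The norm of the library takes its (real, nonnegative) values in the field
   of scalars, that is in R[i] for a complex space. *)
Definition rnorm H (x : H) : R := re_part `|x|.

Definition orthogonal_complement H (S : set H) : set H :=
  [set z | forall s, S s -> ⟨z, s⟩ = 0].

Definition lin_span H (S : set H) : set H :=
  [set z | exists n (b : 'I_n -> H) (c : 'I_n -> scalars R k),
     (forall i, S (b i)) /\ z = \sum_(i < n) c i *: b i].

Definition finite_dimensional H (S : set H) : Prop :=
  exists n (b : 'I_n -> H), S `<=` lin_span (range b).

Definition orthonormal_seq H (e : nat -> H) : Prop :=
  forall i j, ⟨e i, e j⟩ = (i == j)%:R.

Definition complete_in H (e : nat -> H) (M : set H) : Prop :=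
  closure (lin_span (range e)) = M.

(* The value is the unique such p whenever M is a closed subspace. *)
Definition orthogonal_projector H (M : set H) (z : H) : H :=
  xget 0 [set p | M p /\ orthogonal_complement M (z - p)].

Definition kernel X Y (K : X -> Y) : set X := [set x | K x = 0].

Definition compact_operator X Y (K : X -> Y) : Prop :=
  compact (closure (K @` [set x | `|x| <= 1])).

Definition adjoint X Y (K : X -> Y) (y : Y) : X :=
  xget 0 [set x | forall z, ⟨K z, y⟩ = ⟨z, x⟩].

(* For y in R(K) + R(K)^⊥, the value is the unique x in (ker K)^⊥ such that
   K x is the component of y in R(K): this is the linear extension, by 0 on
   R(K)^⊥, of the inverse of the restriction of K to (ker K)^⊥. *)
Definition moore_penrose X Y (K : X -> Y) (y : Y) : X :=
  xget 0 [set x | orthogonal_complement (kernel K) x /\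
                  orthogonal_complement (range K) (y - K x)].

Record singular_value_expansion X Y (K : X -> Y)
    (sigma : nat -> R) (v : nat -> X) (u : nat -> Y) : Prop := {
  sve_noninc : forall m, sigma m.+1 <= sigma m;
  sve_pos : forall m, 0 < sigma m;
  sve_orthonormal_v : orthonormal_seq v;
  sve_complete_v : complete_in v (orthogonal_complement (kernel K));
  sve_orthonormal_u : orthonormal_seq u;
  sve_complete_u : complete_in u (closure (range K));
  sve_Kv : forall m, K (v m) = of_real k (sigma m) *: u m;
  sve_Ku : forall m, adjoint K (u m) = of_real k (sigma m) *: v m
}.

Definition tikhonov_filter (alpha gamma s : R) : R :=
  s `^ (2 * gamma) / (s ^+ 2 + alpha) `^ gamma.

Definition fractional_tikhonov X Y (sigma : nat -> R) (v : nat -> X)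
    (u : nat -> Y) (alpha gamma : R) (y : Y) : X :=
  limn (series (fun m =>
    (of_real k (tikhonov_filter alpha gamma (sigma m) / sigma m) * ⟨y, u m⟩)
      *: v m)).

End Hilbert.

(* h(d) = o(g(d)) as d tends to 0 from above, for a nonnegative h which is
   allowed to be infinite away from 0. *)
Definition littleo_at_right0 (R : realType) (h : R -> \bar R) (g : R -> R) :
    Prop :=
  forall eps : R, 0 < eps ->
    \forall d \near 0^'+, (h d <= (eps * g d)%:E)%E.

(* Main.v *)
Require Import Defs.
From mathcomp Require Import all_boot all_order all_algebra.
From mathcomp Require Import complex ring lra.
From mathcomp Require Import all_classical all_reals all_analysis.

(** Write x for the generalized inverse of K at y, F_a for the filter with
parameter a, and suppose that x <> 0, so that x has a nonzero coordinate c
along some v_i.  Take a later index m with sigma_m = q small, the noise level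
d = q^3, for which d^(2/3) = q^2, and perturb y by d/2 in the direction of u_m.
The reconstruction error then shows two defects.

Along v_m the perturbation is amplified to F_a(q) d / (2 q) = F_a(q) q^2 / 2.
The sign of the perturbation is chosen so that the bias (1 - F_a(q)) <x, v_m>
has a real part that does not cancel this term.  Along v_i, where the data are
exact, the bias (1 - F_a(sigma_i)) |c| remains.

No parameter a makes both of them small against q^2.  If a <= q^2, then
F_a(q) >= 2^(-gamma) ([tikhonov_filter_ge]): the noise along v_m is not damped.
If a >= q^2, then 1 - F_a(sigma_i) >= q^2 / (4 sigma_i^2)
([tikhonov_filter_le], which uses gamma >= 1/2): the bias along v_i is of order
q^2.  So the worst-case error is at least a constant times d^(2/3) along the
noise levels d = sigma_m^3, and these tend to 0 because K is compact
([sigma_arbitrarily_small]).  A rate o(d^(2/3)) is thus impossible.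

The vector y itself may have infinitely many nonzero coordinates.  The noisy
data are therefore a truncated Fourier sum of y, within d/2 of y and long enough
to keep the coordinates i and m intact, plus the perturbation
([perturbed_data]).
The series that defines the reconstruction is then a finite sum, and its
coordinates can be read off without any convergence argument
([inner_fractional_tikhonov]). *)

Set Implicit Arguments.
Unset Strict Implicit.
Unset Printing Implicit Defensive.

Import Order.TTheory GRing.Theory Num.Theory numFieldNormedType.Exports.

Local Open Scope classical_set_scope.
Local Open Scope ring_scope.

(** * Real and complex scalars *)

Section Scalars.
Variables (R : realType) (k : scalar_kind).
Implicit Types (r s : R) (z w : scalars R k).

Lemma re_partD z w : re_part (z + w) = re_part z + re_part w.
Proof. by move: z w; case: k => //= -[a b] [c d]. Qed.

Lemma re_partM_real r z : re_part (of_real k r * z) = r * re_part z.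
Proof. by move: z; case: k => //= -[a b] /=; rewrite mul0r subr0. Qed.

Lemma re_part_of_real r : re_part (of_real k r) = r.
Proof. by case: k. Qed.

Lemma of_real0 : of_real k (0 : R) = 0.
Proof. by case: k. Qed.

Lemma of_real1 : of_real k (1 : R) = 1.
Proof. by case: k. Qed.

Lemma of_realN r : of_real k (- r) = - of_real k r.
Proof. by case: k => //=; rewrite rmorphN. Qed.

Lemma of_realD r s : of_real k (r + s) = of_real k r + of_real k s.
Proof. by case: k => //=; rewrite rmorphD. Qed.

Lemma of_realM r s : of_real k (r * s) = of_real k r * of_real k s.
Proof. by case: k => //=; rewrite rmorphM. Qed.

Lemma of_real_le r s : (of_real k r <= of_real k s) = (r <= s).
Proof. by case: k => //=; rewrite lecR. Qed.

Lemma of_real_lt r s : (of_real k r < of_real k s) = (r < s).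
Proof. by case: k => //=; rewrite ltcR. Qed.

Lemma norm_of_real r : `|of_real k r| = of_real k `|r|.
Proof. by case: k => //=; rewrite normc_def /= expr0n addr0 sqrtr_sqr. Qed.

Lemma of_real_re_norm z : of_real k (re_part `|z|) = `|z|.
Proof. by move: z; case: k => //= z; rewrite RRe_real // normr_real. Qed.

Lemma norm_re_part_le z : `|re_part z| <= re_part `|z|.
Proof.
rewrite -of_real_le of_real_re_norm.
by move: z; case: k => //= z; rewrite normc_ge_Re.
Qed.

Lemma sconj0 : sconj (0 : scalars R k) = 0.
Proof. by case: k => //=; rewrite rmorph0. Qed.

Lemma sconj_of_real r : sconj (of_real k r) = of_real k r.
Proof. by case: k => //=; exact: conjc_real. Qed.

End Scalars.

(** * Geometry of Hilbert spaces *)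

Section HilbertGeometry.
Variables (R : realType) (k : scalar_kind) (H : hilbert R k).
Implicit Types (x y z : H) (e : nat -> H) (c : scalars R k).

Lemma innerC x y : ⟨x, y⟩ = sconj ⟨y, x⟩.
Proof. by rewrite hermitian_subproof expr0 mul1r. Qed.

Lemma innerDl x y z : ⟨x + y, z⟩ = ⟨x, z⟩ + ⟨y, z⟩.
Proof. exact: linearDl. Qed.

Lemma innerBl x y z : ⟨x - y, z⟩ = ⟨x, z⟩ - ⟨y, z⟩.
Proof. exact: linearBl. Qed.

Lemma innerDr x y z : ⟨x, y + z⟩ = ⟨x, y⟩ + ⟨x, z⟩.
Proof. exact: linearDr. Qed.

Lemma innerBr x y z : ⟨x, y - z⟩ = ⟨x, y⟩ - ⟨x, z⟩.
Proof. exact: linearBr. Qed.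

Lemma innerZl c x y : ⟨c *: x, y⟩ = c * ⟨x, y⟩.
Proof. exact: linearZl_LR. Qed.

Lemma innerZr c x y : ⟨x, c *: y⟩ = sconj c * ⟨x, y⟩.
Proof. exact: linearZr_LR. Qed.

Lemma inner_suml n (f : 'I_n -> H) y :
  ⟨\sum_(i < n) f i, y⟩ = \sum_(i < n) ⟨f i, y⟩.
Proof. exact: linear_sumlz. Qed.

Lemma inner_sumr n (f : 'I_n -> H) y :
  ⟨y, \sum_(i < n) f i⟩ = \sum_(i < n) ⟨y, f i⟩.
Proof. exact: linear_sumr. Qed.

Lemma inner0l x : ⟨0, x⟩ = 0.
Proof. exact: linear0l. Qed.

Lemma inner_eq0C x y : ⟨x, y⟩ = 0 -> ⟨y, x⟩ = 0.
Proof. by move=> xy0; rewrite innerC xy0 sconj0. Qed.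

Lemma of_real_rnorm x : of_real k (rnorm x) = `|x|.
Proof.
have h : `|x| = `| `|x| | by rewrite normr_id.
by rewrite /rnorm h of_real_re_norm.
Qed.

Lemma rnorm_ge0 x : 0 <= rnorm x.
Proof. by rewrite -(of_real_le k) of_real0 of_real_rnorm. Qed.

Lemma ler_rnormD x y : rnorm (x + y) <= rnorm x + rnorm y.
Proof. by rewrite -(of_real_le k) of_realD !of_real_rnorm ler_normD. Qed.

Lemma rnormZ (r : R) x : rnorm (of_real k r *: x) = `|r| * rnorm x.
Proof.
by rewrite {1}/rnorm normrZ norm_of_real re_partM_real.
Qed.

Lemma rnorm_sqE x : rnorm x ^+ 2 = re_part ⟨x, x⟩.
Proof.
by rewrite -hilbert_normE -of_real_rnorm !expr2 -of_realM re_part_of_real.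
Qed.

Lemma pythagoras x y : ⟨x, y⟩ = 0 ->
  rnorm (x + y) ^+ 2 = rnorm x ^+ 2 + rnorm y ^+ 2.
Proof.
move=> xy0; rewrite !rnorm_sqE innerDl !innerDr xy0 (inner_eq0C xy0).
by rewrite addr0 add0r re_partD.
Qed.

Lemma ler_rnorm_orthoD x y : ⟨x, y⟩ = 0 -> rnorm x <= rnorm (x + y).
Proof.
move=> xy0; rewrite -(@ler_pXn2r _ 2) ?nnegrE ?rnorm_ge0 //.
by rewrite (pythagoras xy0) lerDl sqr_ge0.
Qed.

Lemma rnorm_unit x : ⟨x, x⟩ = 1 -> rnorm x = 1.
Proof.
move=> x1; apply/eqP; rewrite -(@eqrXn2 _ 2) ?rnorm_ge0 //.
by rewrite rnorm_sqE x1 -of_real1 re_part_of_real expr1n.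
Qed.

(** This case of the Cauchy-Schwarz inequality is the Pythagorean theorem for
the splitting of x into its component along y and the orthogonal rest. *)
Lemma coordinate_le_rnorm x y : ⟨y, y⟩ = 1 -> re_part `|⟨x, y⟩| <= rnorm x.
Proof.
move=> y1; set c := ⟨x, y⟩.
have c0 : ⟨c *: y, x - c *: y⟩ = 0.
  by apply: inner_eq0C; rewrite innerZr innerBl innerZl y1 mulr1 subrr mulr0.
rewrite -[leRHS]/(rnorm x) -[x in leRHS](subrK (c *: y)) [_ + c *: y]addrC.
apply: le_trans (ler_rnorm_orthoD c0).
by rewrite /rnorm normrZ -[`|y|]of_real_rnorm rnorm_unit // of_real1 mulr1.
Qed.

Lemma closure_ball_ex (A : set H) x (r : R) : 0 < r -> closure A x ->
  exists2 z, A z & rnorm (x - z) < r.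
Proof.
move=> r0 /(_ (ball x (of_real k r))) [].
  by apply: nbhsx_ballx; rewrite -(of_real_lt k) of_real0 in r0.
move=> z [Az]; rewrite -ball_normE /= => xz; exists z => //.
by rewrite -(of_real_lt k) of_real_rnorm.
Qed.

(** An element of the span involves finitely many of the vectors; a bound on
their indices is what makes orthogonality to a prefix of e sufficient. *)
Lemma lin_span_ortho e z : lin_span (range e) z ->
  exists n, forall N, (n <= N)%N -> forall x,
    (forall i, (i < N)%N -> ⟨x, e i⟩ = 0) -> ⟨x, z⟩ = 0.
Proof.
move=> [n [b [c [be ->]]]].
have /choice[f fb] : forall i, exists j, e j = b i.
  by move=> i; have [j _ <-] := be i; exists j.
exists (\max_(i < n) (f i).+1)%N => N leN x x0.
rewrite inner_sumr big1 // => i _; rewrite innerZr -fb x0 ?mulr0 //.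
by apply: leq_trans leN; exact: (@leq_bigmax _ (fun i => (f i).+1) i).
Qed.

(** For z in the span, x is orthogonal to z, so |x| <= |x - z|, and the right
side can be made arbitrarily small. *)
Lemma eq0_of_coordinates e x : closure (lin_span (range e)) x ->
  (forall i, ⟨x, e i⟩ = 0) -> x = 0.
Proof.
move=> xe x0; suff : rnorm x <= 0.
  rewrite -(of_real_le k) of_real_rnorm of_real0 normr_le0.
  by move/eqP.
apply/ler_addgt0Pr => r r0; rewrite add0r.
have [z ze /ltW xz] := closure_ball_ex r0 xe.
apply: le_trans xz.
have [n /(_ n (leqnn n) x (fun i _ => x0 i)) xz0] := lin_span_ortho ze.
by apply: ler_rnorm_orthoD; rewrite -scaleN1r innerZr xz0 mulr0.
Qed.

Definition fourier_sum e N x := \sum_(i < N) ⟨x, e i⟩ *: e i.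

Lemma inner_orthonormal_sum e N (c : nat -> scalars R k) j :
  orthonormal_seq e ->
  ⟨\sum_(i < N) c i *: e i, e j⟩ = if (j < N)%N then c j else 0.
Proof.
move=> oe; rewrite inner_suml; case: ltnP => jN.
  rewrite (bigD1 (Ordinal jN)) //= big1 => [|i /negPf ij].
    by rewrite innerZl oe eqxx mulr1 addr0.
  by rewrite innerZl oe -(inj_eq val_inj) /= in ij *; rewrite ij mulr0.
rewrite big1 // => i _; rewrite innerZl oe.
by rewrite (ltn_eqF (leq_trans (ltn_ord i) jN)) mulr0.
Qed.

(** A Fourier sum is the best approximation of x from the span of its terms, so
it is at least as good as any z in the span that is r-close to x, once it is
long enough to involve all the vectors that occur in z. *)
Lemma fourier_sum_approx e x (r : R) M : orthonormal_seq e -> 0 < r ->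
  closure (lin_span (range e)) x ->
  exists2 N, (M <= N)%N & rnorm (x - fourier_sum e N x) <= r.
Proof.
move=> oe r0 xe; have [z ze /ltW xz] := closure_ball_ex r0 xe.
have [n hn] := lin_span_ortho ze.
exists (maxn M n); first exact: leq_maxl.
set N := maxn M n; apply: le_trans xz.
have o i : (i < N)%N -> ⟨x - fourier_sum e N x, e i⟩ = 0.
  move=> iN; rewrite innerBl (inner_orthonormal_sum _ (fun i => ⟨x, e i⟩)) //.
  by rewrite iN subrr.
have -> : x - z = (x - fourier_sum e N x) + (fourier_sum e N x - z).
  by rewrite addrA subrK.
apply: ler_rnorm_orthoD; rewrite innerBr (hn N (leq_maxr _ _) _ o) subr0.
by rewrite inner_sumr big1 // => i _; rewrite innerZr o // mulr0.
Qed.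

(** The projector is a chosen p in M with z - p orthogonal to M.  Such a p has
the norm of z whatever the choice, even if M is not a subspace: orthogonality
to both z and p gives <z, z> = <p, z> and <z, p> = <p, p>. *)
Lemma rnorm_projector (M : set H) z : M z ->
  rnorm (orthogonal_projector M z) = rnorm z.
Proof.
move=> Mz; rewrite /orthogonal_projector; case: xgetP => [p _ [Mp zp]|].
  apply/eqP; rewrite -(@eqrXn2 _ 2) ?rnorm_ge0 // !rnorm_sqE; apply/eqP.
  have e1 : ⟨z, z⟩ = ⟨p, z⟩ by apply/eqP; rewrite -subr_eq0 -innerBl zp.
  have e2 : ⟨z, p⟩ = ⟨p, p⟩ by apply/eqP; rewrite -subr_eq0 -innerBl zp.
  by rewrite e1 [in RHS]innerC e2 -innerC.
by move=> /(_ z)[]; split=> // s _; rewrite subrr inner0l.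
Qed.

End HilbertGeometry.

(** * The fractional Tikhonov filter *)

Section Filter.
Variable R : realType.
Implicit Types a g s q : R.

Lemma tikhonov_filterE a g s : 0 < s -> 0 < a ->
  tikhonov_filter a g s = (s ^+ 2 / (s ^+ 2 + a)) `^ g.
Proof.
move=> s0 a0; have s20 : 0 < s ^+ 2 by rewrite exprn_gt0.
have sa0 : 0 < s ^+ 2 + a by rewrite addr_gt0.
rewrite /tikhonov_filter powRrM powR_mulrn ?ltW //.
rewrite powRM ?ltW ?invr_gt0 //; congr (_ * _).
by rewrite -powRN -powR_inv1 ?ltW // -powRrM mulN1r.
Qed.

(** The base q^2 / (q^2 + a) of the filter is at least 1/2: a parameter up
to q^2 damps the component with singular value q by a bounded factor only. *)
Lemma tikhonov_filter_ge a g q : 0 < q -> 0 < a -> 0 <= g -> a <= q ^+ 2 ->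
  2^-1 `^ g <= tikhonov_filter a g q.
Proof.
move=> q0 a0 g0 aq; rewrite tikhonov_filterE //.
have q20 : 0 < q ^+ 2 by rewrite exprn_gt0.
apply: ge0_ler_powR => //; rewrite ?nnegrE ?invr_ge0 //.
  by rewrite divr_ge0 ?addr_ge0 ?ltW.
rewrite ler_pdivlMr ?addr_gt0 //; lra.
Qed.

(** With t = s^2 / (s^2 + a) <= 1, the condition g >= 1/2 gives
t^g <= sqrt t <= (1 + t) / 2, so the bias 1 - t^g is at least
(1 - t) / 2 = a / (2 (s^2 + a)).  This increases with a, and for a = q^2 <= s^2
it is at least q^2 / (4 s^2). *)
Lemma tikhonov_filter_le a g q s : 0 < q -> q <= s -> 0 < a -> 1 / 2 <= g ->
  q ^+ 2 <= a -> tikhonov_filter a g s <= 1 - q ^+ 2 / (4 * s ^+ 2).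
Proof.
move=> q0 qs a0 g0 aq; have s0 : 0 < s by apply: lt_le_trans qs.
have q20 : 0 < q ^+ 2 by rewrite exprn_gt0.
have s20 : 0 < s ^+ 2 by rewrite exprn_gt0.
have qs2 : q ^+ 2 <= s ^+ 2 by rewrite ler_pXn2r // nnegrE ltW.
have sa0 : 0 < s ^+ 2 + a by rewrite addr_gt0.
rewrite tikhonov_filterE //; set t := _ / _.
have t0 : 0 < t by rewrite divr_gt0.
have t1 : t <= 1 by rewrite ler_pdivrMr // mul1r lerDl ltW.
have th : t <= 1 - q ^+ 2 / (2 * s ^+ 2).
  have -> : 1 - q ^+ 2 / (2 * s ^+ 2) = (2 * s ^+ 2 - q ^+ 2) / (2 * s ^+ 2).
    by field; rewrite ?gt_eqF.
  by rewrite ler_pdivrMr // mulrAC ler_pdivlMr ?mulr_gt0 //; nra.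
have th' : t `^ g <= t `^ 2^-1.
  by apply: ger_powR; [rewrite t0 t1 | rewrite -div1r].
apply: le_trans th' _; rewrite powR12_sqrt ?(ltW t0) //.
(* the inequality 2 r <= 1 + r^2 for r = sqrt t *)
have := sqr_sqrtr (ltW t0); set r := Num.sqrt t => rt.
have : 0 <= (r - 1) ^+ 2 by rewrite sqr_ge0.
have -> : q ^+ 2 / (4 * s ^+ 2) = (q ^+ 2 / (2 * s ^+ 2)) / 2.
  by field; rewrite gt_eqF.
move: th; rewrite -rt; set w := q ^+ 2 / (2 * s ^+ 2); lra.
Qed.

Lemma tikhonov_filter_ge0 a g s : 0 <= tikhonov_filter a g s.
Proof. by rewrite divr_ge0 ?powR_ge0. Qed.

Lemma tikhonov_filter_le1 a g s : 0 < s -> 0 < a -> 0 <= g ->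
  tikhonov_filter a g s <= 1.
Proof.
move=> s0 a0 g0; rewrite tikhonov_filterE //.
have s20 : 0 < s ^+ 2 by rewrite exprn_gt0.
have sa0 : 0 < s ^+ 2 + a by rewrite addr_gt0.
have <- : 1 `^ g = 1 :> R by rewrite powR1.
apply: ge0_ler_powR => //; rewrite ?nnegrE //.
- by rewrite divr_ge0 ?ltW.
- by rewrite ler_pdivrMr // mul1r lerDl ltW.
Qed.

End Filter.

(** * Singular value expansion and reconstruction *)

Section SingularValues.
Variables (R : realType) (k : scalar_kind) (X Y : hilbert R k).
Variables (K : {linear X -> Y}).
Variables (sigma : nat -> R) (v : nat -> X) (u : nat -> Y).
Hypothesis hsve : singular_value_expansion K sigma v u.

Lemma inner_vv i : ⟨v i, v i⟩ = 1.
Proof. by rewrite (sve_orthonormal_v hsve) eqxx. Qed.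

Lemma inner_uu i : ⟨u i, u i⟩ = 1.
Proof. by rewrite (sve_orthonormal_u hsve) eqxx. Qed.

Lemma sigma_noninc i j : (i <= j)%N -> sigma j <= sigma i.
Proof.
by move: i j; apply/nonincreasing_seqP; exact: sve_noninc hsve.
Qed.

Lemma range_u m : range K (u m).
Proof.
exists (of_real k (sigma m)^-1 *: v m) => //.
rewrite linearZ_LR (sve_Kv hsve) scalerA -of_realM mulVf ?of_real1 ?scale1r //.
by rewrite gt_eqF // (sve_pos hsve).
Qed.

(** This is the defining property of the adjoint applied to K* u_m = sigma_m v_m.
If u_m had no adjoint image, the default value 0 would have to equal
sigma_m v_m, which is a nonzero vector. *)
Lemma inner_Ku x m : ⟨K x, u m⟩ = of_real k (sigma m) * ⟨x, v m⟩.
Proof.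
have := sve_Ku hsve m; rewrite /adjoint; case: xgetP => [w -> /= adj wE|_ v0].
  by rewrite adj wE innerZr sconj_of_real.
have := inner_vv m.
have -> : v m = 0.
  apply/eqP; move/esym/eqP: v0; rewrite scaler_eq0 => /orP[|//].
  by rewrite eq_le -of_real0 !of_real_le leNgt (sve_pos hsve).
by rewrite inner0l => /esym/eqP; rewrite oner_eq0.
Qed.

(** The vectors K v_m = sigma_m u_m are pairwise orthogonal images of unit
vectors.  If all but finitely many of them had norm at least r, their mutual
distances would be at least r, so the sequence could not have a cluster point,
against compactness. *)
Lemma sigma_arbitrarily_small : compact_operator K ->
  forall M (r : R), 0 < r -> exists2 m, (M <= m)%N & sigma m < r.
Proof.
move=> cK M r r0; apply: contrapT => nex.
have ler m : (M <= m)%N -> r <= sigma m.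
  by move=> Mm; rewrite leNgt; apply/negP => mr; apply: nex; exists m.
have [|p [_ clp]] := cK ((fun m => K (v m)) @ \oo) _.
  exists 0%N => // m _; apply: subset_closure; exists (v m) => //=.
  by rewrite -of_real_rnorm rnorm_unit ?inner_vv // of_real1.
have r2 : 0 < r / 2 by rewrite divr_gt0.
have near_p N : exists2 m, (N <= m)%N & rnorm (p - K (v m)) < r / 2.
  have [] := clp [set K (v m) | m in [set m | (N <= m)%N]]
                 (ball p (of_real k (r / 2))).
  - by exists N => // m /= Nm; exists m.
  - by apply: nbhsx_ballx; rewrite -of_real0 of_real_lt.
  move=> _ [[m Nm <-]]; rewrite -ball_normE /= => pm; exists m => //.
  by rewrite -(of_real_lt k) of_real_rnorm.
(* two distinct terms within r / 2 of the cluster point are r-close *)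
have [m Mm pm] := near_p M.
have [n mn pn] := near_p m.+1.
have := ler m Mm; apply/negP; rewrite -ltNge.
have -> : sigma m = rnorm (K (v m)).
  rewrite (sve_Kv hsve) rnormZ rnorm_unit ?inner_uu // mulr1.
  by rewrite ger0_norm // ltW // (sve_pos hsve).
have o : ⟨K (v m), - K (v n)⟩ = 0.
  rewrite -scaleN1r (sve_Kv hsve n) !innerZr inner_Ku (sve_orthonormal_v hsve).
  by rewrite (ltn_eqF mn) !mulr0.
apply: le_lt_trans (ler_rnorm_orthoD o) _.
have -> : K (v m) - K (v n) = (p - K (v n)) + of_real k (-1) *: (p - K (v m)).
  by rewrite of_realN of_real1 scaleN1r opprB [RHS]addrC addrA subrK.
apply: le_lt_trans (ler_rnormD _ _) _.
rewrite rnormZ normrN normr1 mul1r; lra.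
Qed.

(** For data with finitely many nonzero coordinates the partial sums are
eventually constant, so the limit exists and is a finite sum. *)
Lemma inner_fractional_tikhonov (a g : R) (z : Y) N j :
  (forall i, (N <= i)%N -> ⟨z, u i⟩ = 0) ->
  ⟨fractional_tikhonov sigma v u a g z, v j⟩ =
    of_real k (tikhonov_filter a g (sigma j) / sigma j) * ⟨z, u j⟩.
Proof.
move=> z0; rewrite /fractional_tikhonov.
pose c m := of_real k (tikhonov_filter a g (sigma m) / sigma m) * ⟨z, u m⟩.
have -> : limn (series (fun m => c m *: v m)) = \sum_(i < N) c i *: v i.
  apply: lim_near_cst; first exact: norm_hausdorff.
  exists N => // n /= Nn; rewrite /series /=.
  rewrite (big_cat_nat (leq0n N) Nn) //= big_mkord.
  rewrite [X in _ + X]big1_seq ?addr0 // => i /andP[_].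
  by rewrite mem_index_iota => /andP[Ni _]; rewrite /c z0 // mulr0 scale0r.
rewrite (inner_orthonormal_sum _ _ _ (sve_orthonormal_v hsve)) /c.
by case: ltnP => // Nj; rewrite z0 // mulr0.
Qed.

End SingularValues.

(** * Worst-case data *)

Section Saturation.
Variables (R : realType) (k : scalar_kind) (X Y : hilbert R k).
Variables (K : {linear X -> Y}).
Variables (sigma : nat -> R) (v : nat -> X) (u : nat -> Y).
Hypothesis hsve : singular_value_expansion K sigma v u.

(** The value 0 is also the default for a y without generalized inverse; a
nonzero value is therefore a genuine one.  It solves K x = y because the
residual lies in the range of K and is orthogonal to it, and it has a nonzero
coordinate because the v_i are complete in the complement of the kernel. *)
Lemma moore_penrose_neq0P y : range K y -> moore_penrose K y != 0 ->
  y = K (moore_penrose K y) /\ exists i, ⟨moore_penrose K y, v i⟩ != 0.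
Proof.
move=> [x _ xy]; rewrite /moore_penrose; case: xgetP => [x0 _|_]; last first.
  by rewrite eqxx.
move=> [/= kerx0 ranx0] x0n0; split.
  apply/eqP; rewrite -subr_eq0 -normr_eq0 -sqrf_eq0 hilbert_normE.
  rewrite [X in ⟨_, X⟩](_ : _ = K (x - x0)); last by rewrite linearB xy.
  by apply/eqP/ranx0; exists (x - x0).
apply: contrapT => nv; apply/negP/negPn: x0n0; apply/eqP.
apply: (@eq0_of_coordinates _ _ _ v).
  by rewrite (sve_complete_v hsve).
by move=> i; apply: contrapT => /eqP vi; apply: nv; exists i.
Qed.

(** The error budget d is split evenly between the truncation of the Fourier
series of y and the perturbation eta u_m.  The range of K contains y - z since
it contains y and every u_j, so the projector does not change the norm of y - z. *)
Lemma perturbed_data (y : Y) (eta d : R) m M :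
  range K y -> 0 < d -> `|eta| <= d / 2 -> (m < M)%N ->
  exists z N, [/\ (M <= N)%N,
    rnorm (orthogonal_projector (closure (range K)) (y - z)) <= d,
    forall j, (j < N)%N ->
      ⟨z, u j⟩ = ⟨y, u j⟩ + of_real k (if j == m then eta else 0) &
    forall j, (N <= j)%N -> ⟨z, u j⟩ = 0].
Proof.
move=> yK d0 etad mM; have d20 : 0 < d / 2 by rewrite divr_gt0.
have ou := sve_orthonormal_u hsve.
have uy : closure (lin_span (range u)) y.
  by rewrite (sve_complete_u hsve); exact: subset_closure.
have [N MN Ny] := fourier_sum_approx M ou d20 uy.
have mN : (m < N)%N by apply: leq_trans MN.
pose z := fourier_sum u N y + of_real k eta *: u m.
have zu j : ⟨z, u j⟩ = (if (j < N)%N then ⟨y, u j⟩ else 0) +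
    of_real k (if j == m then eta else 0).
  rewrite innerDl (inner_orthonormal_sum _ (fun i => ⟨y, u i⟩)) // innerZl ou.
  by rewrite eq_sym; case: eqP; rewrite ?mulr1 ?mulr0 ?of_real0.
exists z, N; split=> // [|j jN|j Nj]; last 2 first.
- by rewrite zu jN.
- by rewrite zu ltnNge Nj /= (gtn_eqF (leq_trans mN Nj)) of_real0 addr0.
have zK : range K (y - z).
  have [x _ <-] := yK.
  have fP i : exists x, K x = u i by have [w _ <-] := range_u hsve i; exists w.
  have [f fu] := choice fP.
  exists (x - (\sum_(i < N) ⟨y, u i⟩ *: f i + of_real k eta *: f m)) => //.
  rewrite linearB linearD linear_sum linearZ_LR fu; congr (_ - (_ + _)).
  by apply: eq_bigr => i _; rewrite linearZ_LR fu.
rewrite rnorm_projector; last exact: subset_closure.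
have -> : y - z = (y - fourier_sum u N y) + of_real k (- eta) *: u m.
  by rewrite /z opprD addrA of_realN scaleNr.
apply: le_trans (ler_rnormD _ _) _; rewrite rnormZ normrN.
rewrite (rnorm_unit (inner_uu hsve m)) mulr1; lra.
Qed.

End Saturation.

Theorem proposition14 (R : realType) (k : scalar_kind) (X Y : hilbert R k)
    (K : {linear X -> Y})
    (hK : compact_operator K)
    (hdim : ~ finite_dimensional (range K))
    (sigma : nat -> R) (v : nat -> X) (u : nat -> Y)
    (hsve : singular_value_expansion K sigma v u)
    (gamma : R) (hgamma : 1 / 2 <= gamma)
    (y : Y) (hy : range K y)
    (alpha : R -> Y -> R)
    (halpha : forall (d : R) (yd : Y), 0 < d -> 0 < alpha d yd)
    (hrate : littleo_at_right0
       (fun d : R => ereal_sup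
          [set (rnorm (fractional_tikhonov sigma v u (alpha d yd) gamma yd
                       - moore_penrose K y))%:E
          | yd in [set yd : Y |
              rnorm (orthogonal_projector (closure (range K)) (y - yd)) <= d]])
       (fun d : R => d `^ (2 / 3))) :
  moore_penrose K y = 0.

Proof.
apply: contrapT => /eqP x0n0.
have [yE [i0 vi0]] := moore_penrose_neq0P hsve hy x0n0.
move: hrate yE vi0 {x0n0}; set x0 := moore_penrose K y => hrate' yE vi0.
have yu j : ⟨y, u j⟩ = of_real k (sigma j) * ⟨x0, v j⟩.
  by rewrite [in LHS]yE (inner_Ku hsve).
have sigma0 := sve_pos hsve; have g0 : 0 <= gamma by lra.
pose s := sigma i0; have s20 : 0 < s ^+ 2 by apply/exprn_gt0/sigma0.
pose c := re_part `|⟨x0, v i0⟩|.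
have c0 : 0 < c.
  by rewrite -(of_real_lt k) of_real_re_norm of_real0 normr_gt0.
(* either term of the minimum is half of the value that would still be
   compatible with one of the two cases on the parameter *)
pose eps := Num.min (2^-1 `^ gamma / 4) (c / (8 * s ^+ 2)).
have p0 : 0 < (2^-1 : R) `^ gamma by rewrite powR_gt0.
have eps0 : 0 < eps by rewrite lt_min !divr_gt0 // mulr_gt0.
have [r /= r0 hr] := hrate' eps eps0.
have qr0 : 0 < Num.min 1 r by rewrite lt_min ltr01.
have [m im] := sigma_arbitrarily_small hsve hK i0.+1 qr0.
set q := sigma m; rewrite lt_min => /andP[q1 qr]; have q0 : 0 < q := sigma0 m.
have q20 : 0 < q ^+ 2 by rewrite exprn_gt0.
pose d := q ^+ 3; have d0 : 0 < d by rewrite exprn_gt0.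
have dr : d < r.
  by apply: le_lt_trans qr; rewrite -[leRHS]expr1 ler_wiXn2l // ltW.
have dq : d `^ (2 / 3) = q ^+ 2.
  rewrite /d -powR_mulrn ?ltW // -powRrM -powR_mulrn ?ltW //.
  by congr (_ `^ _); field.
pose a := re_part ⟨x0, v m⟩.
(* the sign that keeps the bias (F m - 1) a from cancelling the noise *)
pose eta := if a <= 0 then d / 2 else - (d / 2).
have [||z [N [mN zd zu zN]]] :=
    @perturbed_data _ _ _ _ _ _ _ _ hsve y eta d m m.+1 hy d0.
- by rewrite /eta; case: ifP; rewrite ?normrN ger0_norm // divr_ge0 // ltW.
- by [].
pose al := alpha d z; have al0 : 0 < al := @halpha d z d0.
pose F j := tikhonov_filter al gamma (sigma j).
pose e := fractional_tikhonov sigma v u al gamma z - x0.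
have err : rnorm e <= eps * q ^+ 2.
  rewrite -lee_fin -dq.
  have dball : ball_ Num.norm 0 r d by rewrite /= sub0r normrN gtr0_norm.
  apply: le_trans (hr d dball d0).
  by apply: ereal_sup_ubound; exists z.
have ev j : (j < N)%N -> ⟨e, v j⟩ = of_real k (F j - 1) * ⟨x0, v j⟩
    + of_real k (F j / sigma j * if j == m then eta else 0).
  move=> jN; rewrite innerBl (inner_fractional_tikhonov hsve _ _ _ zN) zu // yu.
  have sj : sigma j != 0 by rewrite gt_eqF.
  rewrite mulrDr mulrA -!of_realM mulfVK //.
  by rewrite of_realD of_realN of_real1 mulrBl mul1r addrAC.
have F0 : 0 <= F m by apply: tikhonov_filter_ge0.
have F1 : F m <= 1 by apply: tikhonov_filter_le1.
have err_m : F m * q ^+ 2 / 2 <= eps * q ^+ 2.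
  apply: le_trans err.
  apply: le_trans (coordinate_le_rnorm e (inner_vv hsve m)).
  apply: le_trans (norm_re_part_le _).
  rewrite ev // eqxx re_partD re_partM_real re_part_of_real -/a -/q.
  have -> : F m * q ^+ 2 / 2 = F m / q * (d / 2) by rewrite /d; field; lra.
  have Fq : 0 <= F m / q * (d / 2).
    by apply: mulr_ge0; apply: divr_ge0 => //; exact: ltW.
  rewrite /eta; case: (lerP a 0) => a0.
    by apply: le_trans (ler_norm _); nra.
  rewrite -normrN; apply: le_trans (ler_norm _); nra.
have err_i0 : (1 - F i0) * c <= eps * q ^+ 2.
  apply: le_trans err.
  apply: le_trans (coordinate_le_rnorm e (inner_vv hsve i0)).
  have iN : (i0 < N)%N by apply: ltn_trans mN.
  rewrite ev // (ltn_eqF im) mulr0 of_real0 addr0 normrM norm_of_real.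
  by rewrite re_partM_real distrC ler_wpM2r ?ler_norm ?ltW.
have eps1 : eps <= 2^-1 `^ gamma / 4 by rewrite ge_min lexx.
have eps2 : eps <= c / (8 * s ^+ 2) by rewrite ge_min lexx orbT.
(* noise along v m against bias along v i0 *)
have [alq|/ltW qal] := lerP al (q ^+ 2).
  have := tikhonov_filter_ge q0 al0 g0 alq; rewrite -/(F m).
  have : F m <= 2 * eps by rewrite -(ler_pM2r q20); lra.
  lra.
have := tikhonov_filter_le q0 (sigma_noninc hsve (ltnW im)) al0 hgamma qal.
rewrite -/(F i0) -/s => Fi0.
have : q ^+ 2 / (4 * s ^+ 2) * c <= c / (8 * s ^+ 2) * q ^+ 2.
  apply: le_trans (le_trans err_i0 _); last by rewrite ler_pM2r.
  by rewrite ler_pM2r //; lra.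
have -> : q ^+ 2 / (4 * s ^+ 2) * c = 2 * (c / (8 * s ^+ 2) * q ^+ 2).
  by field; rewrite gt_eqF // sigma0.
have : 0 < c / (8 * s ^+ 2) * q ^+ 2 by rewrite mulr_gt0 // divr_gt0 // mulr_gt0.
lra.
Qed.
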